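(* Let $T:C^1[0,1]\to C^1[0,1]$ be an isometric reflection of Form (I), i.e. there are $c\in\mathbb{C}$ with $|c|=1$, a continuous function $\beta:[0,1]\to\mathbb{C}$ with $|\beta(t)|=1$ for all $t$, and a homeomorphism $\phi:[0,1]\to[0,1]$ such that $$T(f)(t)=T(0)(t)+c f(0)+\int_0^t\beta(s)f'(\phi(s))\,ds$$ for every $f\in C^1[0,1]$ and $t\in[0,1]$. Then $c=\pm1$, and $\beta(t)\beta(\phi(t))=1$ and $\phi^2(t)=t$ for every $t\in[0,1]$.
   Context: $C^1[0,1]$ is the complex linear space of continuously differentiable complex-valued functions on $[0,1]$ with the norm $\|f\|_\sigma=|f(0)|+\|f'\|_\infty$. An isometry is a map $T$ (not assumed linear) with $\|Tf-Tg\|_\sigma=\|f-g\|_\sigma$ for all $f,g$; it is an isometric reflection if $T^2=T\circ T=I$, the identity map. $T(0)\in C^1[0,1]$ denotes the image of the zero function, and $\phi^2=\phi\circ\phi$. *)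

(* Defs.v *)
From Stdlib Require Import Reals Lra.
From Coquelicot Require Import Coquelicot.
Local Open Scope R_scope.

Definition I01 : Type := {t : R | 0 <= t <= 1}.

Definition I01_val (t : I01) : R := proj1_sig t.
Coercion I01_val : I01 >-> R.

Lemma I01_0_proof : 0 <= 0 <= 1.
Proof. lra. Qed.

Definition I01_0 : I01 := exist _ 0 I01_0_proof.

Lemma clamp_proof (s : R) : 0 <= Rmax 0 (Rmin 1 s) <= 1.
Proof. unfold Rmax, Rmin; repeat destruct Rle_dec; lra. Qed.

(* The identity on [0,1]; it only serves to extend integrands to R, since
   RInt takes functions on R. *)
Definition clamp (s : R) : I01 := exist _ (Rmax 0 (Rmin 1 s)) (clamp_proof s).

(* [0,1] carries the uniformity induced by R, so that [locally], [locally']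
   and [continuous] are relative to [0,1] (one-sided at 0 and 1). *)
Definition I01_ball (x : I01) (e : R) (y : I01) : Prop :=
  ball (x : R) e (y : R).

Definition I01_UniformSpace_mixin : UniformSpace.mixin_of I01 :=
  UniformSpace.Mixin I01 I01_0 I01_ball
    (fun x e => ball_center (x : R) e)
    (fun x y e => ball_sym (x : R) (y : R) e)
    (fun x y z e1 e2 => ball_triangle (x : R) (y : R) (z : R) e1 e2).

Canonical I01_UniformSpace : UniformSpace :=
  UniformSpace.Pack I01 I01_UniformSpace_mixin I01.

Definition homeomorphism {U V : UniformSpace} (phi : U -> V) : Prop :=
  (forall t, continuous phi t) /\
  exists psi : V -> U,
    (forall t, psi (phi t) = t) /\ (forall t, phi (psi t) = t) /\
    (forall t, continuous psi t).

Definition is_derive01 (f : I01 -> C) (t : I01) (l : C) : Prop :=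
  filterlim (fun s : I01 => ((f s - f t) / RtoC (s - t)%R)%C)
    (locally' t) (locally l).

Definition ex_derive01 (f : I01 -> C) (t : I01) : Prop :=
  exists l : C, is_derive01 f t l.

(* A total operator, arbitrary where the derivative does not exist. *)
Definition Derive01 (f : I01 -> C) (t : I01) : C :=
  iota (T := C_R_CompleteNormedModule) (is_derive01 f t).

Lemma locally'_I01_proper (t : I01) : ProperFilter (locally' t).
Proof.
split; [| apply within_filter, locally_filter].
intros P [e He].
pose (d := Rmin (e / 2) (1 / 2)).
assert (Hd : 0 < d /\ d < e /\ d <= 1 / 2).
{ destruct e as [e e0]; unfold d, Rmin; simpl; destruct Rle_dec; lra. }
destruct t as [t Ht].
assert (Hs : exists s, 0 <= s <= 1 /\ s <> t /\ Rabs (s - t) < e).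
{ destruct (Rle_dec t (1 / 2)).
  - exists (t + d); repeat split; try lra.
    rewrite Rabs_pos_eq; lra.
  - exists (t - d); repeat split; try lra.
    rewrite Rabs_left; lra. }
destruct Hs as [s [Hs [Hne Hlt]]].
exists (exist _ s Hs); apply He; [exact Hlt |].
intros E; apply (f_equal I01_val) in E; exact (Hne E).
Qed.

Lemma is_derive01_unique (f : I01 -> C) (t : I01) (l : C) :
  is_derive01 f t l -> Derive01 f t = l.
Proof.
intros H.
assert (U : forall l', is_derive01 f t l' -> l' = l).
{ intros l' H'.
  exact (filterlim_locally_unique (V := C_R_NormedModule)
           (FF := Proper_StrongProper _ (locally'_I01_proper t)) _ _ _ H' H). }
exact (iota_unique (V := C_R_CompleteNormedModule) _ _ U H).
Qed.

Definition is_C1 (f : I01 -> C) : Prop :=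
  (forall t, ex_derive01 f t) /\ (forall t, continuous (Derive01 f) t).

Record C1_01 : Type := MkC1_01 { C1_fun :> I01 -> C; C1_is_C1 : is_C1 C1_fun }.

Lemma is_C1_zero : is_C1 (fun _ => RtoC 0).
Proof.
assert (D : forall t, is_derive01 (fun _ => RtoC 0) t (RtoC 0)).
{ intros t.
  apply filterlim_ext with (fun _ : I01 => RtoC 0).
  - intros s; unfold Cdiv; ring.
  - apply filterlim_const. }
split; intros t.
- exists (RtoC 0); apply D.
- apply continuous_ext with (fun _ : I01 => RtoC 0).
  + intros s; symmetry; apply is_derive01_unique, D.
  + apply continuous_const.
Qed.

Definition C1_zero : C1_01 := MkC1_01 (fun _ => RtoC 0) is_C1_zero.

(* [real] is harmless on bounded functions, in particular on continuous ones. *)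
Definition sup_norm (g : I01 -> C) : R :=
  real (Lub_Rbar (fun r => exists t : I01, r = Cmod (g t))).

Definition sigma_norm (f : I01 -> C) : R :=
  Cmod (f I01_0) + sup_norm (Derive01 f).

Definition sigma_dist (f g : C1_01) : R := sigma_norm (fun t => (f t - g t)%C).

Definition isometry (T : C1_01 -> C1_01) : Prop :=
  forall f g : C1_01, sigma_dist (T f) (T g) = sigma_dist f g.

Definition isometric_reflection (T : C1_01 -> C1_01) : Prop :=
  isometry T /\ forall f : C1_01, T (T f) = f.

Definition form_I (T : C1_01 -> C1_01)
    (c : C) (beta : I01 -> C) (phi : I01 -> I01) : Prop :=
  Cmod c = 1 /\
  (forall t, continuous beta t) /\ (forall t, Cmod (beta t) = 1) /\
  homeomorphism phi /\
  forall (f : C1_01) (t : I01),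
    T f t = (T C1_zero t + c * f I01_0 +
             RInt (V := C_R_CompleteNormedModule)
               (fun s : R => beta (clamp s) * Derive01 f (phi (clamp s)))
               0 t)%C.

(* Main.v *)
Require Import Defs.
From Stdlib Require Import Reals Lra ProofIrrelevance.
From Coquelicot Require Import Coquelicot.
Local Open Scope R_scope.

(** Differentiating Form (I) gives [(T f)' = (T 0)' + beta * (f' o phi)], while
    evaluating it at [0] gives [T f 0 = T 0 0 + c * f 0].  Both are affine in
    the data [(f 0, f')] of [f], so applying them twice and using
    [T (T f) = f] yields

    - [f 0 = T 0 0 + c * (T 0 0 + c * f 0)], and
    - [f' = (T 0)' + beta * ((T 0)' o phi) + beta * (beta o phi) * (f' o phi^2)].

    The function [f = 0] shows that the constant terms vanish, which leaves
    [f 0 = c^2 * f 0] and [f' = beta * (beta o phi) * (f' o phi^2)].  The value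
    [f 0] and the continuous function [f'] can be prescribed freely
    ([ex_C1_01_with_data]): [f 0 = 1] gives [c^2 = 1], [f' = 1] gives
    [beta * (beta o phi) = 1], and then [f'] equal to the inclusion of [[0,1]]
    in the complex plane gives [phi^2 = id].

    The analytic content is the fundamental theorem of calculus on [[0,1]]
    ([is_derive01_RInt]), which serves both to differentiate Form (I) and to
    construct the test functions. *)

(** * The interval as a subspace of the real line *)

Lemma I01_ext (s t : I01) : (s : R) = t -> s = t.
Proof.
destruct s as [s Hs], t as [t Ht]; simpl; intros E; subst t.
f_equal; apply proof_irrelevance.
Qed.

Lemma clamp_id (t : I01) : clamp t = t.
Proof.
apply I01_ext; destruct t as [t Ht]; simpl.
unfold Rmax, Rmin; repeat destruct Rle_dec; lra.
Qed.

Lemma continuous_clamp (s : R) : continuous clamp s.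
Proof.
apply filterlim_locally; intros e; exists e; intros y Hy.
assert (Rabs (y - s) < e) as Hy' by exact Hy.
change (Rabs (Rmax 0 (Rmin 1 y) - Rmax 0 (Rmin 1 s)) < e).
revert Hy'; unfold Rabs, Rmax, Rmin.
repeat (destruct Rcase_abs || destruct Rle_dec); lra.
Qed.

Lemma continuous_I01_RtoC (t : I01) : continuous (fun s : I01 => RtoC s) t.
Proof.
apply filterlim_locally; intros e; exists e; intros y Hy; split.
- exact Hy.
- apply ball_center.
Qed.

(** The rule for products in a ring with absolute value uses the uniformity
    defined by [Cmod], which has the same neighborhoods as the product
    uniformity of [C] but is not the same structure. *)
Lemma continuous_Cmult {U : UniformSpace} (f g : U -> C) (x : U) :
  continuous f x -> continuous g x -> continuous (fun y => (f y * g y)%C) x.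
Proof.
intros Hf Hg P HP; apply locally_C in HP; revert P HP.
apply (continuous_mult (K := C_AbsRing) f g x); intros P HP.
- apply Hf, locally_C, HP.
- apply Hg, locally_C, HP.
Qed.

(** * Differentiation on the interval *)

Lemma is_derive01_const (a : C) (t : I01) : is_derive01 (fun _ => a) t (RtoC 0).
Proof.
apply filterlim_ext with (fun _ : I01 => RtoC 0).
- intros s; unfold Cdiv; ring.
- apply filterlim_const.
Qed.

Lemma is_derive01_plus (f g : I01 -> C) (t : I01) (l m : C) :
  is_derive01 f t l -> is_derive01 g t m ->
  is_derive01 (fun s => (f s + g s)%C) t (l + m)%C.
Proof.
intros Hf Hg.
apply filterlim_ext with
  (fun s : I01 => ((f s - f t) / RtoC (s - t) + (g s - g t) / RtoC (s - t))%C).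
- intros s; unfold Cdiv; ring.
- exact (filterlim_comp_2 _ _ _ Hf Hg
           (filterlim_plus (V := C_R_NormedModule) l m)).
Qed.

Lemma Derive01_correct (f : I01 -> C) (t : I01) :
  ex_derive01 f t -> is_derive01 f t (Derive01 f t).
Proof.
intros [l Hl]; rewrite (is_derive01_unique _ _ _ Hl); exact Hl.
Qed.

(** A derivative over [R] bounds the increment by a multiple of [|s - t|];
    restricting to [s] in [[0,1]] and dividing gives the difference quotient. *)
Lemma is_derive_is_derive01 (F : R -> C) (t : I01) (l : C) :
  is_derive (V := C_R_NormedModule) F t l ->
  is_derive01 (fun s : I01 => F s) t l.
Proof.
intros [_ H].
specialize (H t (fun P HP => HP)).
apply (filterlim_locally_ball_norm (U := C_R_NormedModule)); intros eps.
destruct (H (pos_div_2 eps)) as [d Hd].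
exists d; refine (fun (s : I01) Hs Hne => _).
specialize (Hd (I01_val s) Hs).
assert (Hst : s - t <> 0).
{ intros E; apply Hne, I01_ext; lra. }
assert (HC : RtoC (s - t) <> RtoC 0) by (intros E; apply Hst, RtoC_inj, E).
assert (HB : Cmod (F s - F t - RtoC (s - t) * l)%C <= eps / 2 * Rabs (s - t)).
{ replace (F s - F t - RtoC (s - t) * l)%C with
    (minus (G := C_R_NormedModule) (minus (F s) (F t))
       (scal (V := C_R_NormedModule) (minus (s : R) (t : R)) l)).
  - rewrite Cmod_norm; exact Hd.
  - apply injective_projections; simpl; unfold minus, plus, opp, scal; simpl;
      unfold mult; simpl; ring. }
change (norm (V := C_R_NormedModule) ((F s - F t) / RtoC (s - t) - l)%C < eps).
rewrite <- Cmod_norm.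
replace ((F s - F t) / RtoC (s - t) - l)%C
  with ((F s - F t - RtoC (s - t) * l) / RtoC (s - t))%C by (field; exact HC).
rewrite Cmod_div, Cmod_R by exact HC.
assert (0 < Rabs (s - t)) by (apply Rabs_pos_lt, Hst).
apply Rle_lt_trans with (eps / 2).
- apply Rle_div_l; assumption.
- pose proof (cond_pos eps); lra.
Qed.

(** The integrand becomes continuous on all of [R] when it is extended by the
    retraction [clamp], so the fundamental theorem of calculus over [R] applies
    also at the endpoints. *)
Lemma is_derive01_RInt (g : I01 -> C) (t : I01) :
  (forall s, continuous g s) ->
  is_derive01 (fun s : I01 =>
    RInt (V := C_R_CompleteNormedModule) (fun x => g (clamp x)) 0 s) t (g t).
Proof.
intros Hg.
assert (Hc : forall x : R,
  continuous (U := C_R_CompleteNormedModule) (fun x => g (clamp x)) x).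
{ intros x; apply (continuous_comp clamp g).
  - apply continuous_clamp.
  - apply Hg. }
apply (is_derive_is_derive01 (fun s : R =>
  RInt (V := C_R_CompleteNormedModule) (fun x => g (clamp x)) 0 s)).
rewrite <- (clamp_id t) at 2.
apply (is_derive_RInt (V := C_R_NormedModule) (fun x => g (clamp x)) _ 0 t).
- apply filter_forall; intros b.
  apply (RInt_correct (V := C_R_CompleteNormedModule)).
  apply (ex_RInt_continuous (V := C_R_CompleteNormedModule)); intros x _; apply Hc.
- apply Hc.
Qed.

(** Integrating [g] from [0] and adding [a] gives such an [f]: this is the
    supply of test functions for identities in [f 0] and [f']. *)
Lemma ex_C1_01_with_data (a : C) (g : I01 -> C) :
  (forall t, continuous g t) ->
  exists f : C1_01, f I01_0 = a /\ forall t, Derive01 f t = g t.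
Proof.
intros Hg.
pose (F := fun t : I01 =>
  (a + RInt (V := C_R_CompleteNormedModule) (fun x => g (clamp x)) 0 t)%C).
assert (HF : forall t, is_derive01 F t (g t)).
{ intros t; replace (g t) with (RtoC 0 + g t)%C by ring.
  apply is_derive01_plus; [apply is_derive01_const | apply is_derive01_RInt, Hg]. }
assert (HD : forall t, Derive01 F t = g t)
  by (intros t; apply is_derive01_unique, HF).
assert (C1 : is_C1 F).
{ split; intros t.
  - exists (g t); apply HF.
  - apply continuous_ext with g; [intros s; symmetry; apply HD | apply Hg]. }
exists (MkC1_01 F C1); split; [| exact HD].
change (F I01_0 = a); unfold F; simpl.
rewrite RInt_point; apply Cplus_0_r.
Qed.

(** * Form (I) in terms of the value at 0 and the derivative *)

Lemma form_I_at_0 (T : C1_01 -> C1_01) (c : C) (beta : I01 -> C)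
  (phi : I01 -> I01) (HI : form_I T c beta phi) (f : C1_01) :
  T f I01_0 = (T C1_zero I01_0 + c * f I01_0)%C.
Proof.
destruct HI as (_ & _ & _ & _ & HT).
rewrite HT; simpl; rewrite RInt_point; apply Cplus_0_r.
Qed.

Lemma form_I_Derive01 (T : C1_01 -> C1_01) (c : C) (beta : I01 -> C)
  (phi : I01 -> I01) (HI : form_I T c beta phi) (f : C1_01) (t : I01) :
  Derive01 (T f) t =
    (Derive01 (T C1_zero) t + beta t * Derive01 f (phi t))%C.
Proof.
destruct HI as (_ & Hbeta & _ & [Hphi _] & HT).
apply is_derive01_unique.
apply filterlim_ext with (fun s : I01 =>
  ((T C1_zero s + c * f I01_0 +
      RInt (V := C_R_CompleteNormedModule)
        (fun x => beta (clamp x) * Derive01 f (phi (clamp x)))%C 0 s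
    - (T C1_zero t + c * f I01_0 +
      RInt (V := C_R_CompleteNormedModule)
        (fun x => beta (clamp x) * Derive01 f (phi (clamp x)))%C 0 t))
   / RtoC (s - t))%C).
{ intros s; rewrite <- !HT; reflexivity. }
apply (is_derive01_plus (fun s => T C1_zero s + c * f I01_0)%C).
- replace (Derive01 (T C1_zero) t)
    with (Derive01 (T C1_zero) t + RtoC 0)%C by ring.
  apply is_derive01_plus; [| apply is_derive01_const].
  apply Derive01_correct, (C1_is_C1 (T C1_zero)).
- apply (is_derive01_RInt (fun s => beta s * Derive01 f (phi s))%C).
  intros s; apply continuous_Cmult; [apply Hbeta |].
  apply (continuous_comp phi (Derive01 f)); [apply Hphi | apply (C1_is_C1 f)].
Qed.

(** The constant term produced by applying an affine formula twice is
    eliminated by comparison with its value [0] at the zero function. *)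
Lemma form_I_involution_at_0 (T : C1_01 -> C1_01) (c : C) (beta : I01 -> C)
  (phi : I01 -> I01) (HI : form_I T c beta phi)
  (Hinv : forall f, T (T f) = f) (f : C1_01) :
  f I01_0 = (c * c * f I01_0)%C.
Proof.
assert (E : forall g : C1_01,
  g I01_0 = (T C1_zero I01_0 + c * (T C1_zero I01_0 + c * g I01_0))%C).
{ intros g; rewrite <- !(form_I_at_0 _ _ _ _ HI), Hinv; reflexivity. }
pose proof (E C1_zero) as E0; change (C1_zero I01_0) with (RtoC 0) in E0.
rewrite (E f) at 1.
transitivity (T C1_zero I01_0 + c * (T C1_zero I01_0 + c * RtoC 0)
              + c * c * f I01_0)%C; [ring |].
rewrite <- E0; ring.
Qed.

Lemma form_I_involution_Derive01 (T : C1_01 -> C1_01) (c : C) (beta : I01 -> C)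
  (phi : I01 -> I01) (HI : form_I T c beta phi)
  (Hinv : forall f, T (T f) = f) (f : C1_01) (t : I01) :
  Derive01 f t = (beta t * beta (phi t) * Derive01 f (phi (phi t)))%C.
Proof.
set (h := Derive01 (T C1_zero)).
assert (E : forall g : C1_01, Derive01 g t =
  (h t + beta t * (h (phi t) + beta (phi t) * Derive01 g (phi (phi t))))%C).
{ intros g; unfold h; rewrite <- !(form_I_Derive01 _ _ _ _ HI), Hinv; reflexivity. }
pose proof (E C1_zero) as E0.
assert (D0 : forall s, Derive01 C1_zero s = RtoC 0)
  by (intros s; exact (is_derive01_unique _ _ _ (is_derive01_const (RtoC 0) s))).
rewrite !D0 in E0.
rewrite (E f).
transitivity (h t + beta t * (h (phi t) + beta (phi t) * RtoC 0)
              + beta t * beta (phi t) * Derive01 f (phi (phi t)))%C; [ring |].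
rewrite <- E0; ring.
Qed.

Lemma Cmult_self_eq_1 (c : C) :
  (c * c)%C = RtoC 1 -> c = RtoC 1 \/ c = RtoC (-1).
Proof.
intros H.
assert (E : ((c - RtoC 1) * (c + RtoC 1))%C = RtoC 0).
{ transitivity (c * c - RtoC 1)%C; [ring | rewrite H; ring]. }
destruct (Ceq_dec (c - RtoC 1) (RtoC 0)) as [E1 | N1].
- left; apply Ceq_minus; exact E1.
- right; destruct (Ceq_dec (c + RtoC 1) (RtoC 0)) as [E2 | N2].
  + change (-1) with (Ropp 1); rewrite RtoC_opp; apply Ceq_minus; rewrite <- E2; ring.
  + destruct (Cmult_neq_0 _ _ N1 N2 E).
Qed.

Theorem theorem2p1 (T : C1_01 -> C1_01) (c : C) (beta : I01 -> C) (phi : I01 -> I01)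
  (HT : isometric_reflection T) (HI : form_I T c beta phi) :
  (c = RtoC 1 \/ c = RtoC (-1)) /\
  forall t : I01,
    (beta t * beta (phi t))%C = RtoC 1 /\ phi (phi t) = t.
Proof.
destruct HT as [_ Hinv].
destruct (ex_C1_01_with_data (RtoC 1) (fun _ => RtoC 1)) as (f & Hf0 & Hf).
{ intros s; apply continuous_const. }
destruct (ex_C1_01_with_data (RtoC 0) (fun s => RtoC s)) as (g & _ & Hg).
{ apply continuous_I01_RtoC. }
split.
- apply Cmult_self_eq_1.
  pose proof (form_I_involution_at_0 _ _ _ _ HI Hinv f) as E.
  rewrite Hf0, Cmult_1_r in E; symmetry; exact E.
- intros t.
  assert (Hbeta : (beta t * beta (phi t))%C = RtoC 1).
  { pose proof (form_I_involution_Derive01 _ _ _ _ HI Hinv f t) as E.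
    rewrite !Hf, Cmult_1_r in E; symmetry; exact E. }
  split; [exact Hbeta |].
  pose proof (form_I_involution_Derive01 _ _ _ _ HI Hinv g t) as E.
  rewrite !Hg, Hbeta, Cmult_1_l in E.
  apply I01_ext, RtoC_inj; symmetry; exact E.
Qed.
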